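(* Let $n \geq 1$ and $w \geq 1$ be integers, and let $\mu = (\underbrace{w-1,\ldots,w-1}_{n},\underbrace{1,\ldots,1}_{n})$ be the vector consisting of $n$ entries equal to $w-1$ followed by $n$ entries equal to $1$. Then the Kostka number $K_{\lambda\mu}$, where $\lambda$ is the rectangular shape with $w$ columns and $n$ rows, equals $u_n(w)$, the number of permutations $\sigma \in S_n$ whose longest increasing subsequence has length at most $w$.
   Context: For a Young diagram $\lambda$ and a vector $\mu=(\mu_1,\mu_2,\ldots)$ of non-negative integers with $\sum_i \mu_i = |\lambda|$, the Kostka number $K_{\lambda\mu}$ is the number of semistandard Young tableaux of shape $\lambda$ (rows weakly increasing, columns strictly increasing) containing exactly $\mu_i$ copies of the number $i$ for each $i$. An increasing subsequence of $\sigma=(\sigma_1,\ldots,\sigma_n)\in S_n$ is $(\sigma_{i_1},\ldots,\sigma_{i_r})$ with $i_1<\cdots<i_r$ and $\sigma_{i_1}<\cdots<\sigma_{i_r}$. *)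

(* Defs.v *)
From mathcomp Require Import all_boot all_fingroup.
Set Implicit Arguments.
Unset Strict Implicit.
Unset Printing Implicit Defensive.

(* [nth 0 la i] is the length of row i (English convention, rows and columns
   numbered from 0); trailing zero rows are harmless, as they have no cells. *)
Record young_diagram := YoungDiagram {
  row_lengths :> seq nat;
  row_lengthsP : sorted geq row_lengths
}.

Lemma sorted_geq_nseq (n w : nat) : sorted geq (nseq n w).
Proof. by elim: n => [|[|n] IHn] //=; rewrite leqnn. Qed.

Definition rectangle (n w : nat) : young_diagram :=
  YoungDiagram (sorted_geq_nseq n w).

Definition cell (la : young_diagram) : finType :=
  {i : 'I_(size la) & 'I_(nth 0 la i)}.

Definition row_of (la : young_diagram) (c : cell la) : nat := tag c.

Definition col_of (la : young_diagram) (c : cell la) : nat := tagged c.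

(* The entry k : 'I_m stands for the number k + 1. *)
Definition filling (la : young_diagram) (m : nat) : finType :=
  {ffun cell la -> 'I_m}.

Definition semistandard (la : young_diagram) (m : nat) (T : filling la m) :
    bool :=
  [forall c : cell la, forall d : cell la,
     ((row_of c == row_of d) && (col_of c < col_of d) ==> (T c <= T d)) &&
     ((col_of c == col_of d) && (row_of c < row_of d) ==> (T c < T d))].

Definition has_content (la : young_diagram) (mu : seq nat)
    (T : filling la (size mu)) : bool :=
  [forall k : 'I_(size mu), #|[set c : cell la | T c == k]| == nth 0 mu k].

(* The vector mu is extended by zeros, so only the numbers 1, ..., size mu can
   occur.  The value is 0 when the sum of mu is not the number of cells. *)
Definition kostka (la : young_diagram) (mu : seq nat) : nat :=
  #|[set T : filling la (size mu) | semistandard T && has_content T]|.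

(* [t] is the tuple of positions i_1 < ... < i_r. *)
Definition increasing_subsequence (n : nat) (s : 'S_n) (r : nat)
    (t : r.-tuple 'I_n) : bool :=
  sorted ltn [seq val i | i <- t] && sorted ltn [seq val (s i) | i <- t].

(* Strictly increasing positions force r <= n. *)
Definition lis_length (n : nat) (s : 'S_n) : nat :=
  \max_(r < n.+1 | [exists t : r.-tuple 'I_n, increasing_subsequence s t]) r.

Definition u (n w : nat) : nat := #|[set s : 'S_n | lis_length s <= w]|.

(* Main.v *)
Require Import Defs.
From mathcomp Require Import all_boot all_fingroup.
From mathcomp Require Import zify.

(* A semistandard tableau T amounts to the Gelfand-Tsetlin pattern
   r v i = number of entries of row i of T that are at most v.  For the
   rectangle with n rows and w columns and the content ((w-1)^n, 1^n), split the
   pattern at v = n.  For k <= n, complementing the shape r k in the k x w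
   rectangle and the shape r (2n - k) in the n x w rectangle gives two
   partitions of k, and each of these families increases with k, one box at a
   time.  The two chains end at the same partition, the complement of r n, whose
   first part is at most w.  These are the pairs of standard tableaux of equal
   shape, with n boxes and at most w columns.  By RSK they correspond to the
   permutations with longest increasing subsequence at most w.

   RSK is taken in the form of growth diagrams: partitions attached to the
   vertices of the n x n grid such that, around a cell, the three lower ones and
   the entry of the permutation matrix determine the upper one, while the three
   upper ones determine the lower one and the entry.  The first part L obeys the
   recurrence L(i+1, j+1) = max (L(i, j+1), L(i+1, j)) + x(i, j), which computes
   the longest increasing subsequence. *)

Set Implicit Arguments.
Unset Strict Implicit.
Unset Printing Implicit Defensive.

(** * Growth diagrams *)

(* For partitions: mu contains rho and mu / rho is a horizontal strip. *)
Definition interlace (rho mu : nat -> nat) : Prop :=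
  forall k, rho k <= mu k /\ mu k.+1 <= rho k.

(* The piecewise-linear form of the local rule of RSK: it sends an entry x and
   partitions rho <= mu, nu around a grid cell to the partition at the fourth
   corner. *)
Definition grow (x : nat) (rho mu nu : nat -> nat) (k : nat) : nat :=
  if k is k'.+1 then maxn (mu k) (nu k) + minn (mu k') (nu k') - rho k'
  else maxn (mu 0) (nu 0) + x.

(** The local rule read backwards. The entry of the cell is recovered separately, as
    [la 0 - maxn (mu 0) (nu 0)]. *)
Definition shrink (mu nu la : nat -> nat) (k : nat) : nat :=
  minn (mu k) (nu k) + maxn (mu k.+1) (nu k.+1) - la k.+1.

Lemma grow_interlace x rho mu nu :
  interlace rho mu -> interlace rho nu ->
  interlace mu (grow x rho mu nu) /\ interlace nu (grow x rho mu nu).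
Proof.
move=> rmu rnu; split=> -[|k] /=.
- have [? ?] := rmu 0; have [? ?] := rnu 0; lia.
- have [? ?] := rmu k; have [? ?] := rnu k.
  have [? ?] := rmu k.+1; have [? ?] := rnu k.+1; lia.
- have [? ?] := rmu 0; have [? ?] := rnu 0; lia.
- have [? ?] := rmu k; have [? ?] := rnu k.
  have [? ?] := rmu k.+1; have [? ?] := rnu k.+1; lia.
Qed.

Lemma shrink_interlace mu nu la :
  interlace mu la -> interlace nu la ->
  interlace (shrink mu nu la) mu /\ interlace (shrink mu nu la) nu.
Proof.
move=> mula nula; rewrite /shrink; split=> k;
  have [? ?] := mula k; have [? ?] := nula k;
  have [? ?] := mula k.+1; have [? ?] := nula k.+1; lia.
Qed.

(** Index [k] of [shrink] meets index [k.+1] of [grow], where max and min cancel; [rho k] is below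
    the min, so truncated subtraction is exact. *)
Lemma growK x rho mu nu :
  interlace rho mu -> interlace rho nu ->
  shrink mu nu (grow x rho mu nu) =1 rho.
Proof.
move=> rmu rnu k; rewrite /shrink /=.
have [? ?] := rmu k; have [? ?] := rnu k.
by have [? ?] := rmu k.+1; have [? ?] := rnu k.+1; lia.
Qed.

Lemma shrinkK mu nu la :
  interlace mu la -> interlace nu la ->
  grow (la 0 - maxn (mu 0) (nu 0)) (shrink mu nu la) mu nu =1 la.
Proof.
move=> mula nula [|k]; rewrite /shrink /=.
- by have [? ?] := mula 0; have [? ?] := nula 0; lia.
- have [? ?] := mula k; have [? ?] := nula k.
  by have [? ?] := mula k.+1; have [? ?] := nula k.+1; lia.
Qed.

Lemma eq_grow x rho rho' mu mu' nu nu' :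
  rho =1 rho' -> mu =1 mu' -> nu =1 nu' ->
  grow x rho mu nu =1 grow x rho' mu' nu'.
Proof. by move=> e1 e2 e3 [|k] /=; rewrite ?e1 !e2 !e3. Qed.

Lemma eq_shrink mu mu' nu nu' la la' :
  mu =1 mu' -> nu =1 nu' -> la =1 la' -> shrink mu nu la =1 shrink mu' nu' la'.
Proof. by move=> e1 e2 e3 k; rewrite /shrink !e1 !e2 e3. Qed.

(** Each max pairs with the min of the same index. The min at [N] is left without a partner, and the
    last hypothesis equates it with [rho N]. *)
Lemma sum_grow N x rho mu nu :
  interlace rho mu -> interlace rho nu -> minn (mu N) (nu N) = rho N ->
  \sum_(k < N.+1) grow x rho mu nu k + \sum_(k < N.+1) rho k =
  \sum_(k < N.+1) mu k + \sum_(k < N.+1) nu k + x.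
Proof.
move=> rmu rnu hN.
suff H M : \sum_(k < M.+1) grow x rho mu nu k + \sum_(k < M.+1) rho k
             + minn (mu M) (nu M) =
           \sum_(k < M.+1) mu k + \sum_(k < M.+1) nu k + x + rho M.
  by have := H N; lia.
elim: M => [|M IH]; first by rewrite !big_ord_recr !big_ord0 /=; lia.
rewrite !(big_ord_recr M.+1) /=.
have [? ?] := rmu M; have [? ?] := rnu M.
move: IH; move: (\sum_(k < M.+1) grow x rho mu nu k) (\sum_(k < M.+1) rho k).
by move: (\sum_(k < M.+1) mu k) (\sum_(k < M.+1) nu k); lia.
Qed.

(** * Growth from empty shapes on the two axes *)

Section Growth.

Variable x : nat -> nat -> nat.

Fixpoint growth (i : nat) : nat -> nat -> nat :=
  if i is i'.+1 then
    fix row (j : nat) : nat -> nat :=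
      if j is j'.+1 then
        grow (x i' j') (growth i' j') (growth i' j) (row j')
      else fun=> 0
  else fun _ _ => 0.

Lemma growthSS i j :
  growth i.+1 j.+1 =
  grow (x i j) (growth i j) (growth i j.+1) (growth i.+1 j).
Proof. by []. Qed.

Lemma growthx0 i k : growth i 0 k = 0. Proof. by case: i. Qed.

(** The local rule carries interlacing from the lower sides of a cell to its upper sides, so it
    spreads from the axes over the grid. *)
Lemma growth_interlace i j :
  interlace (growth i j) (growth i.+1 j) /\
  interlace (growth i j) (growth i j.+1).
Proof.
have H0 i' : interlace (growth i' 0) (growth i'.+1 0).
  by move=> k; rewrite !growthx0.
elim: i j => [|i IHi] j.
  split; last by move=> k.
  elim: j => [|j IHj]; first exact: H0.
  by rewrite growthSS; apply: (grow_interlace _ _ IHj).1.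
have step j' : interlace (growth i j') (growth i.+1 j') ->
  interlace (growth i j'.+1) (growth i.+1 j'.+1) /\
  interlace (growth i.+1 j') (growth i.+1 j'.+1).
  move=> h; rewrite growthSS.
  by apply: grow_interlace => //; have [] := IHi j'.
have up j' : interlace (growth i j') (growth i.+1 j').
  by have [] := IHi j'.
have right j' := (step j' (up j')).2.
split; last exact: right.
elim: j => [|j IHj]; first exact: H0.
by rewrite growthSS; apply: (grow_interlace _ (right j) IHj).1.
Qed.

Lemma growth_mono i i' j j' k :
  i <= i' -> j <= j' -> growth i j k <= growth i' j' k.
Proof.
move=> hi hj; apply: (@leq_trans (growth i' j k)).
  elim: i' hi => [|i' IH]; first by rewrite leqn0 => /eqP->.
  rewrite leq_eqVlt => /predU1P[->//|/IH h].
  exact: leq_trans h ((growth_interlace i' j).1 k).1.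
elim: j' hj => [|j' IH]; first by rewrite leqn0 => /eqP->.
rewrite leq_eqVlt => /predU1P[->//|/IH h].
exact: leq_trans h ((growth_interlace i' j').2 k).1.
Qed.

Lemma growth_row_bound i j k : i <= k -> growth i j k = 0.
Proof.
elim: i k => [//|i IH] [//|k] hk.
by have [_] := (growth_interlace i j).1 k; rewrite IH // leqn0 => /eqP.
Qed.

(** By [sum_grow], sizes obey inclusion-exclusion around a cell. A shape at height [i] has at most
    [i] parts, so [N >= i] terms suffice. *)
Lemma sum_growth N i j :
  i <= N ->
  \sum_(k < N) growth i j k = \sum_(a < i) \sum_(b < j) x a b.
Proof.
elim: i j => [|i IHi] j hi; first by rewrite big_ord0 big1.
elim: j => [|j IHj].
  rewrite big1 => [|k _]; last by rewrite growthx0.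
  by rewrite big1 // => a _; rewrite big_ord0.
case: N hi IHi IHj => // N hi IHi IHj.
have := @sum_grow N (x i j) _ _ _ (growth_interlace i j).2
  (growth_interlace i j).1.
rewrite -growthSS (IHi _ (ltnW hi)) (IHi _ (ltnW hi)) IHj => h.
rewrite !(@growth_row_bound i) // in h.
have {}h := h (min0n _).
have e m : \sum_(a < i.+1) \sum_(b < m) x a b =
  \sum_(a < i) \sum_(b < m) x a b + \sum_(b < m) x i b by rewrite big_ord_recr.
by move: h; rewrite !e [\sum_(b < j.+1) x i b]big_ord_recr /=; lia.
Qed.

End Growth.

Lemma eq_growth x x' m n i j :
  (forall a b, a < m -> b < n -> x a b = x' a b) ->
  i <= m -> j <= n -> growth x i j =1 growth x' i j.
Proof.
move=> hx; elim: i j => [//|i IHi] j hi; elim: j => [//|j IHj] hj.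
rewrite !growthSS hx //; apply: eq_grow.
- by apply: IHi; apply: ltnW.
- by apply: IHi => //; apply: ltnW.
- by apply: IHj; apply: ltnW.
Qed.

(** By [growK] the far sides fix every shape, working backwards; each entry is then the jump of the
    first part over a max. *)
Lemma growth_inj x x' m n :
  (forall i, i <= m -> growth x i n =1 growth x' i n) ->
  (forall j, j <= n -> growth x m j =1 growth x' m j) ->
  forall i j, i < m -> j < n -> x i j = x' i j.
Proof.
move=> hA hB.
have key i j : i <= m -> j <= n ->
    growth x (m - i) (n - j) =1 growth x' (m - i) (n - j).
  elim: i j => [|i IHi] j hi; first by rewrite subn0 => _; apply/hB/leq_subr.
  elim: j => [|j IHj] hj; first by rewrite subn0; apply/hA/leq_subr.
  have E y : growth y (m - i.+1) (n - j.+1) =1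
     shrink (growth y (m - i.+1) (n - j)) (growth y (m - i) (n - j.+1))
       (growth y (m - i) (n - j)).
    rewrite -(subnSK hi) -(subnSK hj) growthSS => k; apply/esym/growK.
    + exact: (growth_interlace _ _ _).2.
    + exact: (growth_interlace _ _ _).1.
  move=> k; rewrite !E; apply: eq_shrink => //.
  + by apply: IHj; apply: ltnW.
  + by apply: IHi => //; apply: ltnW.
  + by apply: IHi; apply: ltnW.
move=> i j hi hj.
have {}key a b : a <= m -> b <= n -> growth x a b 0 = growth x' a b 0.
  by move=> ha hb; have := key (m - a) (n - b) (leq_subr _ _) (leq_subr _ _) 0;
     rewrite !subKn.
have := key i.+1 j.+1 hi hj; rewrite !growthSS /grow.
rewrite (key i j.+1 (ltnW hi) hj) (key i.+1 j hi (ltnW hj)).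
by move/addnI.
Qed.

(** * Growth diagrams with prescribed far sides *)

Section Backward.

Variables (m n : nat) (A B : nat -> nat -> nat).
Hypotheses (hA : forall i, i < m -> interlace (A i) (A i.+1))
  (hB : forall j, j < n -> interlace (B j) (B j.+1))
  (hA0 : forall k, A 0 k = 0) (hB0 : forall k, B 0 k = 0)
  (hAB : A m =1 B n).

(* Indexed by the distances to the far sides of the grid. *)
Fixpoint regress (i : nat) : nat -> nat -> nat :=
  if i is i'.+1 then
    fix row (j : nat) : nat -> nat :=
      if j is j'.+1 then shrink (row j') (regress i' j) (regress i' j')
      else A (m - i)
  else fun j => B (n - j).

Lemma regressSS i j :
  regress i.+1 j.+1 =
  shrink (regress i.+1 j) (regress i j.+1) (regress i j).
Proof. by []. Qed.

Lemma regressx0 i : i <= m -> regress i 0 =1 A (m - i).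
Proof. by case: i => [|i] _ k //=; rewrite !subn0 hAB. Qed.

Lemma regress_interlace i j :
  (i < m -> j <= n -> interlace (regress i.+1 j) (regress i j)) /\
  (i <= m -> j < n -> interlace (regress i j.+1) (regress i j)).
Proof.
have H0 i' : i' < m -> interlace (regress i'.+1 0) (regress i' 0).
  move=> hi k; rewrite !regressx0 // ?(ltnW hi) //.
  by rewrite -(subnSK hi); apply: hA; lia.
elim: i j => [|i IHi] j.
  have right j' : j' < n -> interlace (regress 0 j'.+1) (regress 0 j').
    by move=> hj k /=; rewrite -(subnSK hj); apply: hB; lia.
  split; last by move=> _; apply: right.
  move=> hm; elim: j => [|j IHj] hj; first exact: H0.
  by rewrite regressSS;
     apply: (shrink_interlace (IHj (ltnW hj)) (right _ hj)).2.
have right j' : i < m -> j' < n ->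
    interlace (regress i.+1 j'.+1) (regress i.+1 j').
  move=> hi hj; rewrite [regress i.+1 j'.+1]regressSS.
  have h1 := (IHi j').2 (ltnW hi) hj.
  have h2 := (IHi j').1 hi (ltnW hj).
  exact: (shrink_interlace h2 h1).1.
split; last exact: right.
move=> hm; elim: j => [|j IHj] hj; first exact: H0.
rewrite regressSS.
exact: (shrink_interlace (IHj (ltnW hj)) (right _ (ltnW hm) hj)).2.
Qed.

(** [A] prescribes the side [j = n] and [B] the side [i = m]. Shrinking fills the grid; entries are
    read off the first parts as in [shrinkK], and growing from them retraces the same shapes. *)
Lemma growth_surj :
  exists x, (forall i, i <= m -> growth x i n =1 A i) /\
            (forall j, j <= n -> growth x m j =1 B j).
Proof.
pose G i j := regress (m - i) (n - j).
pose x i j := G i.+1 j.+1 0 - maxn (G i j.+1 0) (G i.+1 j 0).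
(* Going back along the axis [i = 0] only shrinks the shapes, starting from [A 0], which is
   empty. *)
have G0x j k : j <= n -> G 0 j k = 0.
  move=> hj; rewrite /G subn0; apply/eqP; rewrite -leqn0.
  have -> : 0 = regress m 0 k by rewrite regressx0 // subnn hA0.
  elim: (n - j) (leq_subr j n) => // b IH hb.
  apply: leq_trans (IH (ltnW hb)).
  exact: ((regress_interlace m b).2 (leqnn m) hb k).1.
have Gx0 i k : i <= m -> G i 0 k = 0.
  move=> hi; rewrite /G subn0; apply/eqP; rewrite -leqn0.
  have -> : 0 = regress 0 n k by rewrite /= subnn hB0.
  elim: (m - i) (leq_subr i m) => // a IH ha.
  apply: leq_trans (IH (ltnW ha)).
  exact: ((regress_interlace a n).1 ha (leqnn n) k).1.
have key i j : i <= m -> j <= n -> growth x i j =1 G i j.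
  elim: i j => [|i IHi] j hi; first by move=> hj k; rewrite G0x.
  elim: j => [|j IHj] hj k; first by rewrite Gx0.
  rewrite growthSS (eq_grow _ (IHi _ (ltnW hi) (ltnW hj)) (IHi _ (ltnW hi) hj)
                      (IHj (ltnW hj))).
  have e : G i j = shrink (G i j.+1) (G i.+1 j) (G i.+1 j.+1).
    by rewrite /G -(subnSK hi) -(subnSK hj) regressSS.
  rewrite e shrinkK //.
    rewrite /G -(subnSK hi).
    apply: (regress_interlace (m - i.+1) (n - j.+1)).1; lia.
  rewrite /G -(subnSK hj).
  apply: (regress_interlace (m - i.+1) (n - j.+1)).2; lia.
exists x; split=> [i hi|j hj] k.
  by rewrite key // /G subnn regressx0 ?leq_subr // subKn.
by rewrite key // /G subnn /= subKn.
Qed.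

End Backward.

(** * Longest increasing subsequences *)

(* Extended by zeros to all pairs of naturals. *)
Definition permutation_matrix n (s : 'S_n) (i j : nat) : nat :=
  [exists a : 'I_n, (i == a :> nat) && (j == s a :> nat)].

Lemma permutation_matrixE n (s : 'S_n) (a b : 'I_n) :
  permutation_matrix s a b = (s a == b).
Proof.
congr nat_of_bool; apply/existsP/eqP => [[c /andP[/eqP/val_inj<-]]|<-].
  by move=> /eqP/val_inj.
by exists a; rewrite !eqxx.
Qed.

Lemma permutation_matrix_inj n (s s' : 'S_n) :
  (forall i j, i < n -> j < n ->
     permutation_matrix s i j = permutation_matrix s' i j) -> s = s'.
Proof.
move=> h; apply/permP => a; have := h a (s' a) (ltn_ord a) (ltn_ord (s' a)).
by rewrite !permutation_matrixE eqxx; case: eqP.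
Qed.

Lemma sum_permutation_matrix_row n (s : 'S_n) i :
  i < n -> \sum_(b < n) permutation_matrix s i b = 1.
Proof.
move=> hi; apply/eqP/sum_nat_eq1; exists (s (Ordinal hi)); split=> //.
  by rewrite (permutation_matrixE s (Ordinal hi)) eqxx.
move=> b hb _.
by rewrite (permutation_matrixE s (Ordinal hi)) eq_sym (negPf hb).
Qed.

Lemma sum_permutation_matrix_col n (s : 'S_n) j :
  j < n -> \sum_(a < n) permutation_matrix s a j = 1.
Proof.
move=> hj; apply/eqP/sum_nat_eq1; exists ((s^-1)%g (Ordinal hj)); split=> //.
  by rewrite (permutation_matrixE s _ (Ordinal hj)) permKV eqxx.
move=> a ha _; rewrite (permutation_matrixE s _ (Ordinal hj)).
by case: (s a =P _) => // e; rewrite -e permK eqxx in ha.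
Qed.

(** Naturals with sum 1 have a single nonzero term: row sums define the map, column sums make it
    injective. *)
Lemma permutation_matrix_surj n (x : nat -> nat -> nat) :
  (forall i, i < n -> \sum_(b < n) x i b = 1) ->
  (forall j, j < n -> \sum_(a < n) x a j = 1) ->
  exists s : 'S_n,
    forall i j, i < n -> j < n -> x i j = permutation_matrix s i j.
Proof.
move=> hr hc.
have [f hf] : exists f : 'I_n -> 'I_n,
    forall a : 'I_n, x a (f a) = 1 /\ forall b : 'I_n, b != f a -> x a b = 0.
  apply: (@fin_all_exists _ _ (fun (a b : 'I_n) =>
    x a b = 1 /\ forall c : 'I_n, c != b -> x a c = 0)) => a.
  have /eqP/sum_nat_eq1[b [_ h1 h2]] := hr a (ltn_ord a).
  by exists b; split=> // c hcb; apply: h2.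
have f_inj : injective f.
  move=> a a' e; have /eqP/sum_nat_eq1[b [_ _ h]] := hc (f a) (ltn_ord _).
  have u c : f c = f a -> c = b.
    move=> ec; apply/eqP; apply: contraT => /h/(_ isT).
    by rewrite -ec (hf c).1.
  by rewrite (u a) // (u a').
exists (perm f_inj) => i j hi hj.
rewrite (permutation_matrixE _ (Ordinal hi) (Ordinal hj)) permE.
have [h1 h2] := hf (Ordinal hi).
case: eqP => [e|/eqP ne]; first by rewrite e in h1.
by apply: (h2 (Ordinal hj)); rewrite eq_sym.
Qed.

Section Schensted.

Variables (n : nat) (s : 'S_n).

Let Lambda := growth (permutation_matrix s).

Definition increasing_list (t : seq 'I_n) :=
  sorted ltn [seq val i | i <- t] && sorted ltn [seq val (s i) | i <- t].

Lemma increasing_list_rcons t a :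
  increasing_list (rcons t a) =
  [&& increasing_list t, all (fun b : 'I_n => b < a) t
    & all (fun b => s b < s a) t].
Proof.
rewrite /increasing_list !(sorted_pairwise ltn_trans).
rewrite !map_rcons !pairwise_rcons !all_map.
rewrite (@eq_all _ _ (fun b : 'I_n => b < a)) //.
rewrite (@eq_all _ (preim _ _) (fun b => s b < s a)) //.
by rewrite andbACA andbC.
Qed.

(** The 1 at [(a, s a)], for the last position [a], raises the first part, and the earlier terms lie
    strictly below it in both coordinates. *)
Lemma growth_first_row_ge t i j :
  increasing_list t -> all (fun b : 'I_n => b < i) t ->
  all (fun b => s b < j) t -> size t <= Lambda i j 0.
Proof.
elim/last_ind: t i j => [//|t a IH] i j.
rewrite increasing_list_rcons !all_rcons size_rcons.
move=> /and3P[ht h1 h2] /andP[hi _] /andP[hj _].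
apply: leq_trans (growth_mono _ _ hi hj).
rewrite growthSS /grow permutation_matrixE eqxx addn1 ltnS.
apply: leq_trans (IH _ _ ht h1 h2) _; apply: leq_trans (leq_maxr _ _).
exact: growth_mono.
Qed.

Lemma growth_first_row_attained i j :
  i <= n -> j <= n ->
  exists t, [/\ increasing_list t, all (fun b : 'I_n => b < i) t,
    all (fun b => s b < j) t & size t = Lambda i j 0].
Proof.
elim: i j => [|i IHi] j hi; first by exists [::].
elim: j => [|j IHj] hj; first by exists [::].
pose a := Ordinal hi; pose b := Ordinal hj.
rewrite /Lambda growthSS /grow (permutation_matrixE s a b).
(* The list comes from the better neighbour. If the cell holds a 1, that is the only 1 in its row
   and column, so the list avoids both and [a] can be appended. *)
have [t] : exists t, [/\ increasing_list t, all (fun b : 'I_n => b < i.+1) t,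
    all (fun b => s b < j.+1) t,
    s a == b -> all (fun b : 'I_n => b < i) t && all (fun b => s b < j) t &
    size t = maxn (Lambda i j.+1 0) (Lambda i.+1 j 0)].
  case: (leqP (Lambda i j.+1 0) (Lambda i.+1 j 0)) => _.
    have [t [h1 h2 h3 h4]] := IHj (ltnW hj); exists t; split=> //.
      by apply: sub_all h3 => c; apply: ltnW.
    move=> /eqP sab; rewrite h3 andbT; apply/allP => c ct.
    have /= := allP h2 c ct; rewrite ltnS ltn_neqAle => ->; rewrite andbT.
    apply/eqP => e; have := allP h3 c ct.
    by rewrite (_ : c = a) ?sab /= ?ltnn //; apply: val_inj.
  have [t [h1 h2 h3 h4]] := IHi j.+1 (ltnW hi) hj; exists t; split=> //.
    by apply: sub_all h2 => c; apply: ltnW.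
  move=> /eqP sab; rewrite h2 /=; apply/allP => c ct.
  have /= := allP h3 c ct; rewrite ltnS ltn_neqAle => ->; rewrite andbT.
  apply/eqP => e; have := allP h2 c ct.
  rewrite (_ : c = a) /= ?ltnn //; apply: (@perm_inj _ s).
  by rewrite sab; apply: val_inj.
case: (eqVneq (s a) b) => sab /= [h1 h2 h3 h4 h5]; last first.
  by exists t; rewrite addn0.
have /andP[h6 h7] := h4 isT.
exists (rcons t a).
rewrite increasing_list_rcons !all_rcons size_rcons h5 addn1.
by rewrite sab /= !leqnn h1 h2 h3 h6 h7.
Qed.

Lemma lis_length_leq w : (lis_length s <= w) = (Lambda n n 0 <= w).
Proof.
apply/bigmax_leqP/idP => [h|h r /existsP[t ht]].
  have [t [h1 h2 h3 h4]] := growth_first_row_attained (leqnn n) (leqnn n).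
  have hr : size t < n.+1.
    have /andP[/(sorted_uniq ltn_trans ltnn)/map_uniq/card_uniqP <- _] := h1.
    by rewrite ltnS -[n in _ <= n]card_ord max_card.
  rewrite -h4; apply: (h (Ordinal hr)).
  by apply/existsP; exists (in_tuple t).
apply: leq_trans h; rewrite -(size_tuple t).
by apply: growth_first_row_ge => //; apply/allP => c _ /=.
Qed.

End Schensted.

(** * Semistandard tableaux and Gelfand-Tsetlin patterns *)

Lemma card_ord_lt m k : k <= m -> #|[set i : 'I_m | i < k]| = k.
Proof.
move=> hk; rewrite -sum1dep_card -(big_ord_widen m (fun=> 1) hk).
by rewrite sum1_card card_ord.
Qed.

(** Turns a count into a threshold: used for the small entries of a row, and for the values below
    the entry of a cell. *)
Lemma mem_down_closed m (A : {set 'I_m}) :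
  (forall i j : 'I_m, i <= j -> j \in A -> i \in A) ->
  forall j : 'I_m, (j \in A) = (j < #|A|).
Proof.
move=> hA j; apply/idP/idP => [jA|].
  rewrite -[j.+1](@card_ord_lt m) //; apply/subset_leq_card/subsetP => i.
  by rewrite inE ltnS => /hA; apply.
apply: contraLR => jA; rewrite -leqNgt.
rewrite -[X in _ <= X](@card_ord_lt m); last exact: ltnW.
apply/subset_leq_card/subsetP => i iA; rewrite inE ltnNge.
by apply: contra jA => /hA; apply.
Qed.

Section GelfandTsetlin.

Variables (la : young_diagram) (mu : seq nat).
Local Notation T_ := (filling la (size mu)).

(* Entries are stored minus one: T c < v says that the number in c is at most
   v. *)
Definition row_count (T : T_) (v i : nat) : nat :=
  #|[set c : cell la | (row_of c == i) && (T c < v)]|.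

(** [gt_mono] and [gt_diag] say that consecutive shapes differ by a horizontal strip; [gt_sum] fixes
    its size by the content. *)
Record gt_pattern (r : nat -> nat -> nat) : Prop := GTPattern {
  gt_bot : forall i, r 0 i = 0;
  gt_top : forall i, i < size la -> r (size mu) i = nth 0 la i;
  gt_mono : forall v i, v < size mu -> i < size la -> r v i <= r v.+1 i;
  gt_diag : forall v i, v < size mu -> i.+1 < size la -> r v.+1 i.+1 <= r v i;
  gt_sum : forall v, v < size mu ->
    \sum_(i < size la) r v.+1 i = \sum_(i < size la) r v i + nth 0 mu v }.

Let mkcell (i : 'I_(size la)) (j : 'I_(nth 0 la i)) : cell la :=
  Tagged (fun i : 'I_(size la) => 'I_(nth 0 la i)) j.

Lemma row_count_ord (T : T_) v (i : 'I_(size la)) :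
  row_count T v i = #|[set j : 'I_(nth 0 la i) | T (mkcell j) < v]|.
Proof.
have inj : injective (@mkcell i).
  by move=> j j' /eqP; rewrite eq_Tagged => /eqP.
rewrite -(card_imset _ inj); apply: eq_card => c; rewrite inE.
apply/andP/imsetP => [|[j + ->]]; last by rewrite inE /row_of /= eqxx.
case: c => i' j; rewrite /row_of /= => -[/eqP/val_inj e].
by subst i' => h; exists j; rewrite ?inE.
Qed.

(** Rows increase weakly, so the entries below [v] occupy the leftmost cells of a row. *)
Lemma entry_lt (T : T_) v (c : cell la) :
  semistandard T -> (T c < v) = (col_of c < row_count T v (row_of c)).
Proof.
case: c => i j; move=> /forallP hT; rewrite /col_of /row_of /= row_count_ord.
rewrite -mem_down_closed ?inE // => a b hab; rewrite !inE; apply: leq_ltn_trans.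
move: hab; rewrite leq_eqVlt => /predU1P[/val_inj-> //|hab].
have /forallP/(_ (mkcell b))/andP[/implyP h _] := hT (mkcell a).
by apply: h; rewrite eqxx.
Qed.

Lemma row_count_inj (T T' : T_) :
  semistandard T -> semistandard T' ->
  (forall v i, v <= size mu -> i < size la ->
     row_count T v i = row_count T' v i) -> T = T'.
Proof.
move=> hT hT' h; apply/ffunP => c; apply/val_inj/eqP.
have k v : v <= size mu -> (T c < v) = (T' c < v).
  by move=> hv; rewrite !entry_lt // h // /row_of.
have := k (T c).+1 (ltn_ord _); have := k (T' c).+1 (ltn_ord _).
by rewrite !ltnSn !ltnS eqn_leq => -> <-.
Qed.

Lemma sum_row_count (T : T_) v :
  \sum_(i < size la) row_count T v i = #|[set c | T c < v]|.
Proof.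
rewrite -sum1_card (partition_big (@tag _ _) predT) //=.
apply: eq_bigr => i _; rewrite /row_count -sum1_card; apply: eq_bigl => c.
by rewrite !inE andbC.
Qed.

Lemma card_entries_ltS (T : T_) (k : 'I_(size mu)) :
  #|[set c | T c < k.+1]| = #|[set c | T c < k]| + #|[set c | T c == k]|.
Proof.
rewrite -cardsUI.
have -> : [set c | T c < k] :&: [set c | T c == k] = set0.
  by apply/setP => c; rewrite !inE -val_eqE /=; lia.
rewrite cards0 addn0.
by apply: eq_card => c; rewrite !inE -val_eqE /= ltnS leq_eqVlt orbC.
Qed.

Lemma gt_pattern_row_count (T : T_) :
  semistandard T -> has_content T -> gt_pattern (row_count T).
Proof.
move=> hT /forallP hc; split=> [i|i hi|v i hv hi|v i hv hi|v hv].
- by apply/eqP; rewrite cards_eq0; apply/eqP/setP => c; rewrite !inE andbF.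
- rewrite (row_count_ord T (size mu) (Ordinal hi)) -[RHS]card_ord.
  by apply: eq_card => j; rewrite !inE ltn_ord.
- apply/subset_leq_card/subsetP => c; rewrite !inE => /andP[-> /=].
  exact: ltnW.
- rewrite leqNgt; apply/negP => h.
  have h1 : row_count T v i < nth 0 la i.+1.
    apply: leq_trans h _; rewrite (row_count_ord T _ (Ordinal hi)).
    by rewrite -[X in _ <= X](card_ord (nth 0 la i.+1)) max_card.
  have h2 : row_count T v i < nth 0 la i.
    apply: leq_trans h1 _.
    by have /(sortedP 0) := row_lengthsP la; apply.
  (* Column [row_count T v i] is the first of row [i] with entry at least [v]. If [gt_diag] failed,
     the cell [d] below would hold at most [v], against column strictness. *)
  pose c := @mkcell (Ordinal (ltnW hi)) (Ordinal h2).
  pose d := @mkcell (Ordinal hi) (Ordinal h1).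
  have hd : T d < v.+1 by rewrite entry_lt.
  have hcv : T c < v.
    rewrite ltnS in hd; apply: leq_trans hd.
    have /forallP/(_ c)/forallP/(_ d)/andP[_ /implyP] := hT; apply.
    by rewrite /col_of /row_of /= eqxx ltnSn.
  by move: hcv; rewrite entry_lt // ltnn.
- rewrite !sum_row_count -(eqP (hc (Ordinal hv))).
  exact: card_entries_ltS (Ordinal hv).
Qed.

Lemma gt_pattern_surj r :
  gt_pattern r ->
  exists T : T_, [/\ semistandard T, has_content T &
    forall v i, v <= size mu -> i < size la -> row_count T v i = r v i].
Proof.
case=> r0 rtop rmono rdiag rsum.
have mono v v' i : v <= v' -> v' <= size mu -> i < size la -> r v i <= r v' i.
  move=> + + hi; elim: v' => [|v' IH]; first by rewrite leqn0 => /eqP->.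
  rewrite leq_eqVlt => /predU1P[->//|hv hv'].
  exact: leq_trans (IH hv (ltnW hv')) (rmono _ _ hv' hi).
(* The entry of [c] will be the size of [A c], which is the least [v] such that the row of [r v.+1]
   covers [c]. *)
pose A (c : cell la) := [set v : 'I_(size mu) | r v.+1 (row_of c) <= col_of c].
have hrow (c : cell la) : row_of c < size la by apply: ltn_ord.
have hcol (c : cell la) : col_of c < nth 0 la (row_of c) by apply: ltn_ord.
have memA c (v : 'I_(size mu)) : (v \in A c) = (v < #|A c|).
  apply: mem_down_closed => a b hab; rewrite !inE; apply: leq_trans.
  by apply: mono.
have hA c : #|A c| < size mu.
  rewrite ltnNge; apply/negP => h.
  case e: (size mu) => [|m].
    by move: (hcol c); rewrite -rtop // e r0.
  have hm : m < size mu by rewrite e.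
  have := leq_trans hm h; rewrite -(memA c (Ordinal hm)) inE /= -e rtop //.
  by rewrite leqNgt hcol.
pose T : T_ := [ffun c => Ordinal (hA c)].
have hT c v : v <= size mu -> (T c < v) = (col_of c < r v (row_of c)).
  rewrite ffunE /=; case: v => [|v] hv; first by rewrite r0 !ltn0.
  by rewrite ltnS leqNgt -(memA c (Ordinal hv)) inE /= -ltnNge.
have hrc v i : v <= size mu -> i < size la -> row_count T v i = r v i.
  move=> hv hi; rewrite (row_count_ord T v (Ordinal hi)).
  have hr : r v i <= nth 0 la i by rewrite -rtop //; apply: mono.
  rewrite -[RHS](card_ord_lt hr).
  by apply: eq_card => j; rewrite !inE hT.
exists T; split=> //.
- apply/forallP => c; apply/forallP => d; apply/andP; split; apply/implyP.
    move=> /andP[/eqP hr hcl]; rewrite -ltnS hT // hr.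
    by apply: ltn_trans hcl _; rewrite -hT.
  move=> /andP[/eqP hcl hr]; rewrite hT; last exact: ltnW.
  have : col_of d < r (T d).+1 (row_of d) by rewrite -hT.
  rewrite hcl => /leq_trans; apply.
  (* For rows further apart, [rdiag] and [rmono] alternate up to the row of [c]. *)
  elim: (row_of d) hr (hrow d) => [//|i IH]; rewrite ltnS leq_eqVlt.
  move=> /predU1P[->|hr] hi; first exact: rdiag.
  apply: leq_trans (IH hr (ltnW hi)); apply: leq_trans (rdiag _ _ _ hi) _ => //.
  by apply: rmono; rewrite // ltnW.
- apply/forallP => k; apply/eqP/(@addnI #|[set c | T c < k]|).
  rewrite -card_entries_ltS -!sum_row_count.
  rewrite (eq_bigr (fun i : 'I__ => r k.+1 i)) => [|i _]; last exact: hrc.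
  rewrite rsum //; congr (_ + _); apply: eq_bigr => i _; rewrite hrc //.
  exact: ltnW.
Qed.

End GelfandTsetlin.

(** * The rectangle *)

(** The correspondence is given by equations rather than by a function, so cardinals are compared
    through a relation. *)
Lemma leq_card_rel (S T : finType) (P : {set S}) (Q : {set T})
    (R : S -> T -> Prop) :
  (forall a, a \in P -> exists2 b, b \in Q & R a b) ->
  (forall a a' b, a \in P -> a' \in P -> R a b -> R a' b -> a = a') ->
  #|P| <= #|Q|.
Proof.
move=> tot inj; case: (set_0Vmem P) => [->|[a0 /tot[b0 _ _]]].
  by rewrite cards0.
have [f hf] : exists f : S -> T, forall a, a \in P -> f a \in Q /\ R a (f a).
  apply: (@fin_all_exists _ _ (fun a b => a \in P -> b \in Q /\ R a b)) => a.
  case: (boolP (a \in P)) => [/tot[b]|_]; last by exists b0.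
  by exists b.
rewrite -(@card_in_imset _ _ f) => [|a a' aP a'P e].
  by apply/subset_leq_card/subsetP => _ /imsetP[a aP ->]; apply: (hf a aP).1.
by apply: inj (hf a aP).2 _ => //; rewrite e; apply: (hf a' a'P).2.
Qed.

Lemma sum_ord_trunc k n (F : nat -> nat) :
  k <= n -> (forall i, k <= i -> i < n -> F i = 0) ->
  \sum_(i < n) F i = \sum_(i < k) F i.
Proof.
move=> hk h; rewrite (big_ord_widen _ F hk) [RHS]big_mkcond.
by apply: eq_bigr => i _; case: ltnP => // ki; apply: h.
Qed.

Lemma sum_complement k w (f g : nat -> nat) :
  (forall i, i < k -> f (k - i.+1) + g i = w) ->
  \sum_(i < k) f i + \sum_(i < k) g i = k * w.
Proof.
move=> h; rewrite (reindex_inj rev_ord_inj) -big_split /=.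
rewrite (eq_bigr (fun=> w)) => [|i _]; last exact: h.
by rewrite sum_nat_const card_ord.
Qed.

Section Rectangle.

Variables n w : nat.
Hypotheses (hn : 1 <= n) (hw : 1 <= w).

Let mu := nseq n (w - 1) ++ nseq n 1.
Let la := rectangle n w.

Let size_mu : size mu = n + n.
Proof. by rewrite size_cat !size_nseq. Qed.

Let size_la : size la = n.
Proof. exact: size_nseq. Qed.

Let nth_la i : i < n -> nth 0 la i = w.
Proof. by rewrite nth_nseq => ->. Qed.

Let nth_mu v : v < n + n -> nth 0 mu v = if v < n then w - 1 else 1.
Proof.
move=> hv; rewrite nth_cat size_nseq !nth_nseq.
by case: (ltnP v n) => // hvn; case: ltnP => //; lia.
Qed.

(** The complements are rotated by a half-turn, hence the reversed row indices. Stated as sums, the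
    equations let either side determine the other. *)
Definition complementary (r A B : nat -> nat -> nat) : Prop :=
  forall k, k <= n ->
    (forall i, i < k -> r k (k - i.+1) + A k i = w) /\
    (forall i, i < n -> r (n + n - k) (n - i.+1) + B k i = w).

Lemma gt_pattern_le r v i :
  gt_pattern la mu r -> v <= n + n -> i < n -> r v i <= w.
Proof.
move=> hr hv hi.
have := gt_top hr; have := gt_mono hr; rewrite size_la size_mu => mono top.
rewrite -(nth_la hi) -top //.
have le d : d + v <= n + n -> r v i <= r (d + v) i.
  elim: d => // d IH hd; apply: leq_trans (IH (ltnW hd)) _.
  exact: mono.
by rewrite -(subnK hv); apply: le; rewrite subnK.
Qed.

(** Strict columns force every number in row [i], counted from 0, to be at least [i + 1]. *)
Lemma gt_pattern_eq0 r v i :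
  gt_pattern la mu r -> v <= n + n -> v <= i -> i < n -> r v i = 0.
Proof.
move=> hr; have := gt_diag hr; rewrite size_la size_mu => diag.
elim: v i => [|v IH] [|i] // hv; first by rewrite (gt_bot hr).
  by rewrite (gt_bot hr).
move=> hvi hi; apply/eqP; rewrite -leqn0 -(IH i) ?diag //; lia.
Qed.

Lemma gt_pattern_sum_lower r k :
  gt_pattern la mu r -> k <= n -> \sum_(i < n) r k i = k * (w - 1).
Proof.
move=> hr; have := gt_sum hr; rewrite size_la size_mu => hs.
elim: k => [|k IH] hk; first by rewrite big1 // => i _; rewrite (gt_bot hr).
have hk2 : k < n + n by lia.
by rewrite hs // IH ?nth_mu ?hk ?mulSn 1?addnC // ltnW.
Qed.

Lemma gt_pattern_sum_upper r k :
  gt_pattern la mu r -> k <= n -> \sum_(i < n) r (n + n - k) i + k = n * w.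
Proof.
move=> hr; have := gt_sum hr; have := gt_top hr.
rewrite size_la size_mu => top hs.
elim: k => [|k IH] hk.
  rewrite subn0 addn0 (eq_bigr (fun=> w)) ?sum_nat_const ?card_ord //.
  by move=> i _; rewrite top // nth_la.
have {IH} := IH (ltnW hk).
have -> : n + n - k = (n + n - k.+1).+1 by lia.
have hk2 : n + n - k.+1 < n + n by lia.
rewrite hs // nth_mu // (_ : _ < n = false); last by lia.
by rewrite -addnA add1n.
Qed.

Lemma permutation_of_gt_pattern r :
  gt_pattern la mu r ->
  exists2 s : 'S_n, lis_length s <= w &
    let L := growth (permutation_matrix s) in
    complementary r (fun k => L k n) (fun k => L n k).
Proof.
move=> hr.
have := gt_top hr; have := gt_mono hr; have := gt_diag hr.
rewrite size_la size_mu => diag mono top.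
pose A k i := if i < k then w - r k (k - i.+1) else 0.
pose B k i := if i < n then w - r (n + n - k) (n - i.+1) else 0.
(* The rectangle gains a row at each step, so [diag] gives containment and [mono] the strip
   condition; for [B] the rectangle is fixed and the roles swap. *)
have hA k : k < n -> interlace (A k) (A k.+1).
  move=> hk i; rewrite /A !ltnS; split; case: (ltnP i k) => // hi.
    rewrite (ltnW hi) subSS; apply: leq_sub2l.
    by rewrite -(subnSK hi); apply: diag; lia.
  by rewrite subSS; apply: leq_sub2l; apply: mono; lia.
have hB k : k < n -> interlace (B k) (B k.+1).
  move=> hk i; rewrite /B; have e : n + n - k = (n + n - k.+1).+1 by lia.
  split.
    by case: (ltnP i n) => // hi; rewrite e; apply/leq_sub2l/mono; lia.
  case: (ltnP i.+1 n) => // hi; rewrite (ltnW hi) e; apply: leq_sub2l.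
  by rewrite -(subnSK hi); apply: diag; lia.
have hB0 k : B 0 k = 0.
  rewrite /B; case: ltnP => // hk; rewrite subn0 top ?nth_la ?subnn //; lia.
have hAB : A n =1 B n by move=> i; rewrite /A /B addnK.
have [x [xA xB]] := growth_surj hA hB (fun=> erefl) hB0 hAB.
have cA k i : k <= n -> i < k -> r k (k - i.+1) + A k i = w.
  move=> hk hi; rewrite /A hi subnKC //; apply: gt_pattern_le => //; lia.
have cB k i : k <= n -> i < n -> r (n + n - k) (n - i.+1) + B k i = w.
  move=> hk hi; rewrite /B hi subnKC //; apply: gt_pattern_le => //; lia.
(* [A k] has size [k], so the first [k] rows of [x] sum to [k] and each row sums to 1; [sumB] serves
   the columns. *)
have sumA k : k <= n -> \sum_(a < k) \sum_(b < n) x a b = k.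
  move=> hk; rewrite -(@sum_growth x n) //.
  rewrite (eq_bigr (fun i : 'I_n => A k i)) => [|i _]; last exact: xA.
  rewrite (@sum_ord_trunc k) // => [|i hi _]; last by rewrite /A ltnNge hi.
  have := sum_complement (cA k ^~ hk); rewrite -(@sum_ord_trunc k n (r k)) //.
    rewrite gt_pattern_sum_lower //; move: (\sum_(i < k) _) => S; nia.
  by move=> i hi hin; apply: gt_pattern_eq0 => //; lia.
have sumB k : k <= n -> \sum_(a < n) \sum_(b < k) x a b = k.
  move=> hk; rewrite -(@sum_growth x n) //.
  rewrite (eq_bigr (fun i : 'I_n => B k i)) => [|i _]; last exact: xB.
  have := sum_complement (cB k ^~ hk); have := gt_pattern_sum_upper hr hk.
  by move: (\sum_(i < n) _) (\sum_(i < n) _) => S S'; lia.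
have [||s hs] := @permutation_matrix_surj n x.
- move=> i hi; have := sumA _ hi.
  by rewrite big_ord_recr /= (sumA _ (ltnW hi)) -addn1 => /addnI.
- move=> j hj; have := sumB _ hj.
  rewrite (eq_bigr (fun a : 'I_n => \sum_(b < j) x a b + x a j)) => [|a _].
    by rewrite big_split /= (sumB _ (ltnW hj)) -addn1 => /addnI.
  by rewrite big_ord_recr.
exists s.
  by rewrite lis_length_leq -(eq_growth hs) // xA // /A hn leq_subr.
move=> L k hk; rewrite /L; split=> i hi.
  by rewrite -(eq_growth hs) // xA // cA.
by rewrite -(eq_growth hs) // xB // cB.
Qed.

Lemma gt_pattern_of_permutation (s : 'S_n) :
  lis_length s <= w ->
  let L := growth (permutation_matrix s) in
  exists2 r, gt_pattern la mu r &
    complementary r (fun k => L k n) (fun k => L n k).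
Proof.
rewrite lis_length_leq => hs L.
have Lrow i j : interlace (L i j) (L i.+1 j) := (growth_interlace _ i j).1.
have Lcol i j : interlace (L i j) (L i j.+1) := (growth_interlace _ i j).2.
(* Every shape lies inside [L n n], whose largest part is the first; hence the subtractions from [w]
   below are exact. *)
have Lw i j k : i <= n -> j <= n -> L i j k <= w.
  move=> hi hj; apply: leq_trans hs; apply: leq_trans (growth_mono _ k hi hj) _.
  elim: k => // k; apply: leq_trans.
  exact: leq_trans (Lrow n n k.+1).1 (Lrow n n k).2.
have sumL k : k <= n -> \sum_(i < n) L k n i = k.
  move=> hk; rewrite sum_growth // (eq_bigr (fun=> 1)) => [|a _].
    by rewrite sum1_card card_ord.
  by rewrite sum_permutation_matrix_row // (leq_trans _ hk).
have sumL' k : k <= n -> \sum_(i < n) L n k i = k.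
  move=> hk; rewrite sum_growth // exchange_big.
  rewrite (eq_bigr (fun=> 1)) => [|a _] /=.
    by rewrite sum1_card card_ord.
  by rewrite sum_permutation_matrix_col // (leq_trans _ hk).
(* The two formulas agree at [v = n], where both complement [L n n]. The step from [n] to [n.+1]
   relies on this. *)
pose r v i := if v <= n then if i < v then w - L v n (v - i.+1) else 0
              else w - L n (n + n - v) (n - i.+1).
have lower k i : k <= n -> i < k -> r k i = w - L k n (k - i.+1).
  by rewrite /r => -> ->.
have upper k i : k <= n -> i < n -> r (n + n - k) i = w - L n k (n - i.+1).
  move=> hk hi; rewrite /r; case: (leqP (n + n - k) n) => h.
    have -> : k = n by lia.
    by rewrite addnK hi.
  by rewrite subKn //; lia.
have low0 k i : k <= n -> k <= i -> r k i = 0.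
  by rewrite /r => -> h; rewrite ltnNge h.
have comp : complementary r (fun k => L k n) (fun k => L n k).
  move=> k hk; split=> i hi.
    by rewrite lower ?subnSK ?subKn ?subnK ?Lw //; lia.
  by rewrite upper ?subnSK ?subKn ?subnK ?Lw //; lia.
exists r => //.
have sum_lower k : k <= n -> \sum_(i < n) r k i + k = k * w.
  move=> hk; rewrite (@sum_ord_trunc k) // => [|i hi _]; last exact: low0.
  rewrite -(sum_complement (comp k hk).1).
  rewrite -(@sum_ord_trunc k n (L k n)) ?sumL //.
  by move=> i hi _; apply: growth_row_bound.
have sum_upper k : k <= n -> \sum_(i < n) r (n + n - k) i + k = n * w.
  by move=> hk; rewrite -(sum_complement (comp k hk).2) sumL'.
have split_v v : v < n + n ->
    v < n \/ exists k, [/\ k < n, v = n + n - k.+1 & v.+1 = n + n - k].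
  move=> hv; case: (ltnP v n) => hvn; first by left.
  by right; exists (n + n - v.+1); split; lia.
split; rewrite ?size_la ?size_mu.
- by move=> i; apply: low0.
- move=> i hi; rewrite nth_la // -[n + n]subn0 upper // /L growthx0 subn0 //.
- move=> v i /split_v[hv hi|[k [hk -> ->]] hi]; last first.
    by rewrite !upper ?(ltnW hk) //; apply: leq_sub2l; apply: (Lcol n k _).1.
  case: (ltnP i v) => hiv; last by rewrite low0 // ltnW.
  rewrite !lower ?(ltnW hv) // ?(ltnW hiv) //; last by rewrite ltnS ltnW.
  rewrite subSS -(subnSK hiv); apply: leq_sub2l; exact: (Lrow v n _).2.
- move=> v i /split_v[hv hi|[k [hk -> ->]] hi]; last first.
    rewrite !upper ?(ltnW hk) ?(ltnW hi) //; apply: leq_sub2l.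
    rewrite -(subnSK hi); exact: (Lcol n k _).2.
  case: (ltnP i v) => hiv; last by rewrite low0.
  rewrite !lower ?(ltnW hv) // subSS; apply: leq_sub2l; exact: (Lrow v n _).1.
- move=> v hv; rewrite nth_mu //.
  case: (split_v v hv) => [hvn|[k [hk e e']]].
    have := sum_lower _ hvn; have := sum_lower _ (ltnW hvn); rewrite hvn.
    by move: (\sum_(i < n) _) (\sum_(i < n) _) => S S'; nia.
  have := sum_upper _ hk; have := sum_upper _ (ltnW hk).
  rewrite -e -e' (_ : v < n = false); last by lia.
  by move: (\sum_(i < n) _) (\sum_(i < n) _) => S S'; lia.
Qed.

End Rectangle.

Theorem theorem2p1 (n w : nat) (hn : 1 <= n) (hw : 1 <= w) :
  kostka (rectangle n w) (nseq n (w - 1) ++ nseq n 1) = u n w.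
Proof.
set la := rectangle n w; set mu := nseq n (w - 1) ++ nseq n 1.
have size_mu : size mu = n + n by rewrite size_cat !size_nseq.
have size_la : size la = n by exact: size_nseq.
pose L (s : 'S_n) := growth (permutation_matrix s).
pose R (T : filling la (size mu)) s :=
  complementary n w (row_count T) (fun k => L s k n) (fun k => L s n k).
apply/eqP; rewrite eqn_leq; apply/andP; split.
- apply: (@leq_card_rel _ _ _ _ R) => [T|T T' s].
    rewrite inE => /andP[hT hc].
    have gtT := gt_pattern_row_count hT hc.
    have [s hs hR] := permutation_of_gt_pattern hn hw gtT.
    by exists s; rewrite ?inE.
  rewrite !inE => /andP[hT hc] /andP[hT' hc'] hR hR'.
  apply: row_count_inj => // v i; rewrite size_mu size_la => hv hi.
  have := gt_pattern_row_count hT hc; have := gt_pattern_row_count hT' hc'.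
  (* [complementary] constrains row [i] of the lower half only for [i < v]; both counts vanish
     elsewhere. *)
  move=> /gt_pattern_eq0 z' /gt_pattern_eq0 z.
  case: (leqP v n) => hvn.
    case: (leqP v i) => hiv; first by rewrite z ?z'.
    have := (hR v hvn).1 (v - i.+1); have := (hR' v hvn).1 (v - i.+1).
    rewrite subnSK // subKn; last exact: ltnW.
    by lia.
  have hk : n + n - v <= n by lia.
  have := (hR _ hk).2 (n - i.+1); have := (hR' _ hk).2 (n - i.+1).
  rewrite subnSK // !subKn //; last exact: ltnW.
  by lia.
- apply: (@leq_card_rel _ _ _ _ (fun s T => R T s)) => [s|s s' T].
    rewrite inE => hs; have [r hr hR] := gt_pattern_of_permutation hn hw hs.
    have [T [hT hc hTr]] := gt_pattern_surj hr.
    exists T; first by rewrite inE hT.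
    move=> k hk; have [h1 h2] := hR k hk.
    by split=> i hi; rewrite hTr ?h1 ?h2 // ?size_mu ?size_la; lia.
  (* The counts of [T] fix the shapes on both far sides, hence the whole matrix. *)
  move=> _ _ hR hR'; apply/permutation_matrix_inj/growth_inj => [k|k] hk i.
    have [h _] := hR k hk; have [h' _] := hR' k hk.
    case: (ltnP i k) => hi; last by rewrite !growth_row_bound.
    by apply: (@addnI (row_count T k (k - i.+1))); rewrite h // h'.
  have [_ h] := hR k hk; have [_ h'] := hR' k hk.
  case: (ltnP i n) => hi; last by rewrite !growth_row_bound.
  by apply: (@addnI (row_count T (n + n - k) (n - i.+1))); rewrite h // h'.
Qed.
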